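(* Let $m\in\mathbb{N}$ and let $\boldsymbol{p}_m=(p_0,\dots,p_m)$ be a probability vector with all $p_j>0$. Let $\mathbb{X}_m$ be the two-sided discrete stochastic hull of the random noble means substitution $\zeta_m$, let $S$ be the shift on $\mathbb{X}_m$, and let $\mu_m$ be the $S$-invariant Borel probability measure on $\mathbb{X}_m$ determined by $\mu_m(\mathcal{Z}_k(w))=\boldsymbol{R}_{m,\ell}(w)$ for all $k\in\mathbb{Z}$, $\ell\in\mathbb{N}$ and all $\zeta_m$-legal words $w$ of length $\ell$. Then $\mu_m$ is ergodic (with respect to $S$).
   Context: Alphabet and words. $\mathcal{A}_2=\{\mathtt a,\mathtt b\}$; $\mathcal{A}_2^*$ is the set of finite words (including the empty word), $|w|$ is the length of $w$, $|w|_v$ is the number of occurrences of $v$ in $w$ as a (connected) subword, and $w_{[j,k]}=w_j\cdots w_k$. $\mathcal{A}_2^{\mathbb{Z}}$ carries the product topology, generated by the cylinder sets $\mathcal{Z}_k(v)=\{w\in\mathcal{A}_2^{\mathbb{Z}} : w_{[k,k+|v|-1]}=v\}$ ($k\in\mathbb{Z}$, $v\in\mathcal{A}_2^*$); finite words are regarded as embedded in $\mathcal{A}_2^{\mathbb{Z}}$. The shift is $(Sx)_i=x_{i+1}$. Random noble means substitution. $\zeta_m$ maps $\mathtt a\mapsto \mathtt a^{i}\mathtt b\mathtt a^{m-i}$ with probability $p_i$ ($0\le i\le m$) and $\mathtt b\mapsto\mathtt a$; it is applied to a word letter by letter, with the image of every single letter chosen separately and independently, and the images are concatenated. Any word that can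 be obtained in this way is called an image of the original word; images under $\zeta_m^k$ are obtained by iterating $k$ times. Hull. Let $X_m$ be the set of all $w\in\mathcal{A}_2^{\mathbb{Z}}$ that are accumulation points of a sequence $(\zeta_m^k(\mathtt a|\mathtt a))_{k\in\mathbb{N}_0}$ of images of $\mathtt a|\mathtt a$, where $|$ marks the origin (between positions $-1$ and $0$). $\mathbb{X}_m$ is the smallest closed and shift-invariant subset of $\mathcal{A}_2^{\mathbb{Z}}$ containing $X_m$. Cylinder sets are understood as intersected with $\mathbb{X}_m$. Legal words. $w\in\mathcal{A}_2^*$ is $\zeta_m$-legal if it is a subword of at least one image of $\mathtt b$ under $\zeta_m^k$ for some $k\in\mathbb{N}$; $\mathcal{D}_{m,\ell}$ is the set of legal words of length $\ell$. Induced substitution. For $\ell\in\mathbb{N}$, the induced random substitution $(\zeta_m)_\ell$ on the alphabet $\mathcal{D}_{m,\ell}$ is as follows: for $w\in\mathcal{D}_{m,\ell}$ with first letter $w_0$, if $v=v_0v_1\cdots$ is an image of $w$ under $\zeta_m$ occurring with probability $p$, then with probability $p$ the letter $w$ is mapped to the word $\bigl(v_{[k,k+\ell-1]}\bigr)_{0\le k\le |\zeta_m(w_0)|-1}$ over $\mathcal{D}_{m,\ell}$, where $|\zeta_m(\mathtt a)|=m+1$ and $|\zeta_m(\mathtt b)|=1$. Its substitution matrix $M_{m,\ell}$ has as entry at (row $u$, column $w$), for $u,w\in\mathcal{D}_{m,\ell}$, the expected number of occurrences of the letter $u$ in the random image of $w$ under $(\zeta_m)_\ell$. The matrix $M_{m,\ell}$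 is primitive; $\boldsymbol{R}_{m,\ell}$ is its right Perron–Frobenius eigenvector normalised to have entries summing to $1$, and $\boldsymbol{R}_{m,\ell}(w)$ is its entry at $w$. The values $\boldsymbol{R}_{m,\ell}(w)$ consistently define a shift-invariant measure on cylinder sets, which extends uniquely to the Borel $\sigma$-algebra of $\mathbb{X}_m$; this extension is $\mu_m$. *)

(* Defs.v *)
From HB Require Import structures.
From mathcomp Require Import all_boot all_order all_algebra.
From mathcomp Require Import all_classical all_reals all_analysis.
From mathcomp Require Import complex.

Set Implicit Arguments.
Unset Strict Implicit.
Unset Printing Implicit Defensive.

Import Order.TTheory GRing.Theory Num.Theory.

Local Open Scope classical_set_scope.
Local Open Scope ring_scope.

(* The alphabet is [bool], with its discrete topology. *)
Notation letter := bool (only parsing).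
Notation word := (seq letter).
Definition la : letter := false.
Definition lb : letter := true.

Section substitution.
Variable m : nat.

(* The random choice [i] is ignored when [x] is the letter b. *)
Definition zeta_letter (i : 'I_m.+1) (x : letter) : word :=
  if x == la then nseq i la ++ lb :: nseq (m - i) la else [:: la].

(* [c] lists the independent choices, one for each letter of [w]. *)
Definition zeta_word (c : seq 'I_m.+1) (w : word) : word :=
  flatten [seq zeta_letter q.1 q.2 | q <- zip c w].

Definition zeta_length (x : letter) : nat := if x == la then m.+1 else 1%N.

Definition is_image (w v : word) : Prop :=
  exists2 c : seq 'I_m.+1, size c = size w & v = zeta_word c w.

Fixpoint is_iter_image (k : nat) (w v : word) : Prop :=
  if k is k'.+1 then exists2 u, is_iter_image k' w u & is_image u v
  else v = w.

Definition legal (w : word) : Prop :=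
  exists k v, [/\ (0 < k)%N, is_iter_image k [:: lb] v & infix w v].

Definition legal_words (l : nat) : {set l.-tuple letter} :=
  [set w : l.-tuple letter | `[< legal w >]]%SET.

(* The image of [w] under the induced substitution, for the choices [c]; its
   letters are words of length [l]. *)
Definition induced_image (l : nat) (c : seq 'I_m.+1) (w : word) : seq word :=
  [seq take l (drop k (zeta_word c w)) | k <- iota 0 (zeta_length (head la w))].

End substitution.

(* A word of length [l] receives the choices [c] with probability
   [\prod_t p (tnth c t)]: the choices are independent with law [p]. The unused
   choices made at the letters b sum out to 1. *)
Definition induced_matrix (R : realType) (m : nat) (p : 'I_m.+1 -> R) (l : nat) :
    'M[R]_#|legal_words m l| :=
  \matrix_(i < #|legal_words m l|, j < #|legal_words m l|) \sum_(c : l.-tuple 'I_m.+1)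
    (\prod_(t < l) p (tnth c t)) *
    (count_mem (enum_val i : word) (induced_image l c (enum_val j)))%:R.

(* For a nonnegative matrix the Perron-Frobenius eigenvalue is its spectral
   radius. The left and right eigenvalues of a square matrix coincide, so the
   library's [eigenvalue], which is about row vectors, is the right notion. *)
Definition PF_eigenvalue (R : realType) (n : nat) (M : 'M[R]_n) (lam : R) : Prop :=
  eigenvalue M lam /\
  forall z : R[i],
    eigenvalue (map_mx (real_complex R) M) z -> `|z| <= real_complex R lam.

Definition right_PF_eigenvector (R : realType) (n : nat) (M : 'M[R]_n)
    (v : 'cV[R]_n) : Prop :=
  exists lam : R, [/\ PF_eigenvalue M lam, M *m v = lam *: v,
    forall i, 0 < v i 0 & \sum_i v i 0 = 1].

Definition config : Type := {ptws int -> letter}.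
HB.instance Definition _ := Topological.on config.

Definition shift (x : config) : config := fun i => x (i + 1).

Definition cylinder (k : int) (v : word) : set config :=
  [set x : config | mkseq (fun i => x (k + i%:Z)) (size v) = v].

Section hull.
Variable m : nat.

(* The configurations that carry an image of a|a under the [k]-th power of the
   substitution, its mark being at the origin. How the two-sided word is
   completed outside its support is left free: for [0 < m] this does not affect
   accumulation points, because the images grow on both sides of the mark. *)
Definition seed_images (k : nat) : set config :=
  [set x | exists u v, [/\ is_iter_image m k [:: la] u,
     is_iter_image m k [:: la] v & cylinder (- (size u)%:Z) (u ++ v) x]].

Definition hull_generators : set config :=
  [set w | exists2 x : nat -> config,
     (forall k, seed_images k (x k)) & cluster (x @ \oo) w].

Definition hull : set config :=
  smallest [set Y : set config | closed Y /\ shift @` Y = Y] hull_generators.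

(* [set_type] carries the subspace topology. *)
Definition hull_space : Type := set_type hull.
HB.instance Definition _ := Topological.on hull_space.

Lemma shift_hull_subproof (x : hull_space) : shift (\val x) \in hull.
Proof.
rewrite inE => Y [[cY sY] GY]; rewrite -sY; exists (\val x) => //.
exact: (set_valP x).
Qed.

Definition shift_hull (x : hull_space) : hull_space := SigSub (shift_hull_subproof x).

Lemma is_iter_image_ex k w : exists v, is_iter_image m k w v.
Proof.
elim: k => [|k [u wu]]; first by exists w.
exists (zeta_word (nseq (size u) (ord0 : 'I_m.+1)) u); exists u => //.
by exists (nseq (size u) ord0) => //; rewrite size_nseq.
Qed.

Lemma seed_images_nonempty k : seed_images k !=set0.
Proof.
have [u iu] := is_iter_image_ex k [:: la].
exists (fun i => nth la (u ++ u) (absz (i + (size u)%:Z))); exists u, u; split=> //.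
rewrite /cylinder /=; apply: (@eq_from_nth _ la); rewrite size_mkseq// => i il.
by rewrite nth_mkseq// addrAC addNr add0r absz_nat.
Qed.

Lemma hull_nonempty : hull !=set0.
Proof.
have [x hx] := choice seed_images_nonempty.
have cT : compact [set: config].
  have := @tychonoff int (fun=> bool) (fun=> setT) (fun=> bool_compact).
  by congr (compact _); apply/seteqP; split.
have [w [_ xw]] := cT (x @ \oo) _ filterT.
by exists w => Y [_]; apply; exists x.
Qed.

Definition hull_point : hull_space :=
  SigSub (mem_set (projT2 (cid hull_nonempty))).

HB.instance Definition _ := isPointed.Build hull_space hull_point.

Definition hull_borel : measurableType (@open hull_space).-sigma :=
  g_sigma_algebraType (@open hull_space).

Definition hull_cylinder (k : int) (v : word) : set hull_space :=
  [set x : hull_space | cylinder k v (\val x)].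

End hull.

Definition invariant_measure d (T : measurableType d) (R : realType)
    (mu : probability T R) (f : T -> T) : Prop :=
  forall A, measurable A -> mu (f @^-1` A) = mu A.

Definition ergodic d (T : measurableType d) (R : realType)
    (mu : probability T R) (f : T -> T) : Prop :=
  measurable_fun setT f /\ invariant_measure mu f /\
  forall A, measurable A -> f @^-1` A = A -> mu A = 0%E \/ mu A = 1%E.

(* Main.v *)
(** The length of zeta^k(x) depends only on the letter x and on k, and the
    images under zeta^k of distinct letters are independent. If e_k(x) is the
    expected number of occurrences of v in zeta^k(x), the determinant
    e_k(b) |zeta^k(a)| - e_k(a) |zeta^k(b)| changes sign from k to k + 1 up to an
    error O(|zeta^k(a)|) due to occurrences across block boundaries; hence, with
    c = e_k(a) / |zeta^k(a)|, the centred count G(u) = |u|_v - c |u| has bounded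
    mean on both zeta^k(a) and zeta^k(b), uniformly in k. A second moment estimate
    over blocks then shows that, for k and afterwards n large, G^2 has mean at most
    eps^2 n^2 on every window of length n in the image under zeta^k of an arbitrary
    word. By the eigenvector equation mu is, up to normalisation, its own image
    under zeta^k, with each origin in the block of the letter at 0 counted once, so the
    frequency of v in a mu-random window of length n is within O(eps) of c in L^1.
    Consequently an invariant set is independent of every cylinder, and so of
    itself. *)
Require Import Defs.
From mathcomp Require Import all_boot all_order all_algebra.
From mathcomp Require Import all_classical all_reals all_analysis.
From mathcomp Require Import ring lra zify.

Set Implicit Arguments.
Unset Strict Implicit.
Unset Printing Implicit Defensive.

Import Order.TTheory GRing.Theory Num.Theory.

Local Open Scope classical_set_scope.
Local Open Scope ring_scope.

(** * Occurrences and means under the random substitution *)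

Section occurrences.
Variable v : seq bool.

(** Only nonempty suffixes are tested: the empty [v] is counted [size u] times, which keeps the
    count at most [size u] for every [v]. *)
Fixpoint occ (u : seq bool) : nat :=
  if u is _ :: u' then (prefix v u + occ u')%N else 0%N.

Lemma occ_cons x u : occ (x :: u) = (prefix v (x :: u) + occ u)%N.
Proof. by []. Qed.

Lemma occ_le_size u : (occ u <= size u)%N.
Proof.
elim: u => // x u IH; rewrite occ_cons.
by case: (prefix v (x :: u)); rewrite /size -/size; lia.
Qed.

Lemma prefix_cat_le u1 u2 : (prefix v u1 <= prefix v (u1 ++ u2))%N.
Proof.
case h: (prefix v u1) => //; move: h => /prefixP[s ->].
by rewrite -catA prefix_prefix.
Qed.

Lemma prefix_cat_short u1 u2 :
  (size v <= size u1)%N -> prefix v (u1 ++ u2) = prefix v u1.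
Proof. by move=> h; rewrite !prefixE takel_cat. Qed.

Lemma occ_cat_ge u1 u2 : (occ u1 + occ u2 <= occ (u1 ++ u2))%N.
Proof.
elim: u1 => // x u IH; have := prefix_cat_le (x :: u) u2.
by rewrite cat_cons !occ_cons; lia.
Qed.

(** An occurrence across the seam starts among the last [size v] letters of [u1]. The minimum
    carries the induction: while [u1] is shorter than [v], each letter pays for its own start. *)
Lemma occ_cat_min u1 u2 :
  (occ (u1 ++ u2) <= occ u1 + occ u2 + minn (size u1) (size v))%N.
Proof.
elim: u1 => [|x u IH]; first by rewrite min0n addn0.
rewrite cat_cons !occ_cons -cat_cons.
have [h|h] := leqP (size v) (size (x :: u)).
  by rewrite prefix_cat_short//; move: h; rewrite /size -/size; lia.
by move: h; rewrite /size -/size;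
  case: (prefix v _) => /=; lia.
Qed.

Lemma occ_cat_le u1 u2 : (occ (u1 ++ u2) <= occ u1 + occ u2 + size v)%N.
Proof. by have := occ_cat_min u1 u2; lia. Qed.

Lemma occE n u : size u = n -> occ u = (\sum_(i < n) prefix v (drop i u))%N.
Proof.
move=> <-; elim: u => [|x u IH]; first by rewrite big_ord0.
by rewrite big_ord_recl drop0 occ_cons IH.
Qed.

End occurrences.

(** * Lengths and means of images under powers of the substitution *)

Section expectation.
Variables (R : realType) (m : nat) (p : 'I_m.+1 -> R).
Hypothesis p_ge0 : forall j, 0 <= p j.
Hypothesis p_sum1 : \sum_j p j = 1.

Fixpoint iter_len (k : nat) (x : bool) : nat :=
  if k is k'.+1 then
    if x == la then (m * iter_len k' la + iter_len k' lb)%N else iter_len k' la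
  else 1%N.

Definition iter_lenw k (w : word) : nat := sumn (map (iter_len k) w).

Lemma iter_lenw_cat k u w : iter_lenw k (u ++ w) = (iter_lenw k u + iter_lenw k w)%N.
Proof. by rewrite /iter_lenw map_cat sumn_cat. Qed.

Lemma iter_lenw0 w : iter_lenw 0 w = size w.
Proof. by rewrite /iter_lenw; elim: w => //= x w ->. Qed.

Lemma iter_lenw_zeta_letter k i x : iter_lenw k (@zeta_letter m i x) = iter_len k.+1 x.
Proof.
rewrite /zeta_letter /=; case: eqP => _; last by rewrite /iter_lenw /= addn0.
rewrite iter_lenw_cat /iter_lenw /= !map_nseq !sumn_nseq.
have := ltn_ord i; rewrite ltnS => im.
suff -> : (m * iter_len k la = (i + (m - i)) * iter_len k la)%N by ring.
by rewrite subnKC.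
Qed.

Lemma size_zeta_letter i x : size (@zeta_letter m i x) = zeta_length m x.
Proof.
rewrite /zeta_letter /zeta_length; case: eqP => _ //.
by rewrite size_cat /= !size_nseq addnS subnKC// -ltnS.
Qed.

Lemma iter_len_gt0 k x : (0 < iter_len k x)%N.
Proof. by elim: k x => [|k IH] x //=; case: ifP => _ //; have := IH lb; lia. Qed.

Lemma size_le_iter_lenw k w : (size w <= iter_lenw k w)%N.
Proof.
elim: w => //= x w IH; rewrite /iter_lenw /= -/(iter_lenw k w).
by have := iter_len_gt0 k x; lia.
Qed.

Hypothesis m_gt0 : (0 < m)%N.

Lemma iter_len_lb_le k : (iter_len k lb <= iter_len k la)%N.
Proof. by case: k => //= k; nia. Qed.

Lemma iter_len_le_la k x : (iter_len k x <= iter_len k la)%N.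
Proof. by case: x => //; exact: iter_len_lb_le. Qed.

Lemma iter_len_la_leS k : (iter_len k.+1 la <= m.+1 * iter_len k la)%N.
Proof. by rewrite /=; have := iter_len_lb_le k; nia. Qed.

Lemma iter_len_la_le k : (iter_len k la <= m.+1 * iter_len k lb)%N.
Proof. by case: k => //= k; have := iter_len_lb_le k; nia. Qed.

Lemma leq_iter_len k : (k <= iter_len k la)%N.
Proof.
by elim: k => //= k IH; have := iter_len_gt0 k lb; nia.
Qed.

(** The mean of [F] over the random image of [w], as a finite sum. As in [induced_matrix], a choice
    is averaged at every letter, b included. *)
Fixpoint expect1 (w : word) (F : word -> R) : R :=
  if w is x :: w' then \sum_i p i * expect1 w' (fun v => F (zeta_letter i x ++ v))
  else F [::].

(* The recursion reads zeta^(k+1) as zeta^k o zeta, while [is_iter_image] reads it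
   as zeta o zeta^k. *)
Fixpoint expect (k : nat) (w : word) (F : word -> R) : R :=
  if k is k'.+1 then expect1 w (fun v => expect k' v F) else F w.

(** The comparison is restricted to words [v] with the lengths forced on an image of [w], for all
    [k] at once; this carries the length constraint through the remaining steps in [expect_le]. *)
Lemma expect1_le w F F' :
  (forall v, (forall k, iter_lenw k v = iter_lenw k.+1 w) -> F v <= F' v) ->
  expect1 w F <= expect1 w F'.
Proof.
elim: w F F' => [|x w IH] F F' h /=; first exact: h.
apply: ler_sum => i _; apply: ler_wpM2l => //; apply: IH => v hv.
by apply: h => k; rewrite iter_lenw_cat iter_lenw_zeta_letter hv.
Qed.

Lemma expect_le k w F F' :
  (forall v, size v = iter_lenw k w -> F v <= F' v) -> expect k w F <= expect k w F'.
Proof.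
elim: k w => [|k IH] w h /=; first by apply: h; rewrite iter_lenw0.
by apply: expect1_le => v hv; apply: IH => v' hv'; apply: h; rewrite hv' hv.
Qed.

Lemma expect_eq k w F F' :
  (forall v, size v = iter_lenw k w -> F v = F' v) -> expect k w F = expect k w F'.
Proof.
by move=> h; apply/eqP; rewrite eq_le; apply/andP; split;
  apply: expect_le => v /h ->.
Qed.

Lemma expect1_eq w F F' :
  (forall v, (forall k, iter_lenw k v = iter_lenw k.+1 w) -> F v = F' v) ->
  expect1 w F = expect1 w F'.
Proof.
by move=> h; apply/eqP; rewrite eq_le; apply/andP; split;
  apply: expect1_le => v /h ->.
Qed.

Lemma expect1_lin w a b F F' :
  expect1 w (fun v => a * F v + b * F' v) = a * expect1 w F + b * expect1 w F'.
Proof.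
elim: w F F' => [|x w IH] F F' //=.
rewrite !mulr_sumr -big_split /=; apply: eq_bigr => i _.
by rewrite IH; ring.
Qed.

Lemma expect_lin k w a b F F' :
  expect k w (fun v => a * F v + b * F' v) = a * expect k w F + b * expect k w F'.
Proof.
elim: k w => [|k IH] w //=; rewrite -expect1_lin.
by apply: expect1_eq => v _; rewrite IH.
Qed.

Lemma expect1_const w c : expect1 w (fun=> c) = c.
Proof.
elim: w => [|x w IH] //=.
by rewrite -[RHS]mul1r -p_sum1 mulr_suml; apply: eq_bigr => i _; rewrite IH.
Qed.

Lemma expect_const k w c : expect k w (fun=> c) = c.
Proof.
elim: k w => [|k IH] w //=; rewrite -[RHS](expect1_const w).
by apply: expect1_eq => v _.
Qed.

Lemma expectD k w F F' : expect k w (fun v => F v + F' v) = expect k w F + expect k w F'.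
Proof.
have := expect_lin k w 1 1 F F'; rewrite !mul1r => <-.
by apply: expect_eq => v _; rewrite !mul1r.
Qed.

Lemma expectZ k w a F : expect k w (fun v => a * F v) = a * expect k w F.
Proof.
have := expect_lin k w a 0 F F; rewrite mul0r addr0 => <-.
by apply: expect_eq => v _; rewrite mul0r addr0.
Qed.

Lemma expect_sum k w (I : Type) (r : seq I) (F : I -> word -> R) :
  expect k w (fun v => \sum_(i <- r) F i v) = \sum_(i <- r) expect k w (F i).
Proof.
elim: r => [|i r IH].
  by rewrite big_nil -[RHS](expect_const k w); apply: expect_eq => v _; rewrite big_nil.
by rewrite big_cons -IH -expectD; apply: expect_eq => v _; rewrite big_cons.
Qed.

Lemma expect1_cat u w F :
  expect1 (u ++ w) F = expect1 u (fun u' => expect1 w (fun w' => F (u' ++ w'))).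
Proof.
elim: u F => [|x u IH] F //=; apply: eq_bigr => i _; rewrite IH.
by congr (_ * _); apply: expect1_eq => u' _; apply: expect1_eq => w' _; rewrite catA.
Qed.

(** Fubini for two independent images; it yields the independence of neighbouring blocks in
    [expect_cat]. *)
Lemma expect1_comm w F : forall k u, expect1 w (fun w' => expect k u (fun v => F v w')) =
  expect k u (fun v => expect1 w (F v)).
Proof.
move=> k u; elim: w F => [|x w IH] F //=.
rewrite expect_sum; apply: eq_bigr => i _; rewrite expectZ; congr (_ * _).
by rewrite (IH (fun v w' => F v (zeta_letter i x ++ w'))).
Qed.

Lemma expect_cat k u w F :
  expect k (u ++ w) F = expect k u (fun u' => expect k w (fun w' => F (u' ++ w'))).
Proof.
elim: k u w F => [|k IH] u w F //=; rewrite expect1_cat.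
apply: expect1_eq => u' _; rewrite -expect1_comm.
by apply: expect1_eq => w' _; rewrite IH.
Qed.

Lemma expect_abs_le k w F c :
  (forall v, size v = iter_lenw k w -> `|F v| <= c) -> `|expect k w F| <= c.
Proof.
move=> h; rewrite ler_norml; apply/andP; split.
  rewrite -(expect_const k w (- c)); apply: expect_le => v /h.
  by rewrite ler_norml => /andP[].
rewrite -[leRHS](expect_const k w c); apply: expect_le => v /h.
by rewrite ler_norml => /andP[].
Qed.

Lemma expectB k w F F' : expect k w (fun v => F v - F' v) = expect k w F - expect k w F'.
Proof.
rewrite -[- expect k w F']mulN1r -expectZ -expectD.
by apply: expect_eq => v _; rewrite mulN1r.
Qed.

Lemma expect_const_cat k u w F F' :
  expect k u (fun u' => expect k w (fun w' => F u' + F' w')) =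
  expect k u F + expect k w F'.
Proof.
rewrite (@expect_eq _ _ _ (fun u' => F u' + expect k w F')); last first.
  by move=> v _; rewrite expectD expect_const.
by rewrite expectD expect_const.
Qed.

(** A quasimorphism on words, of defect at most [l]. *)
Definition almost_additive (l : R) (G : word -> R) :=
  forall u w, `|G (u ++ w) - G u - G w| <= l.

Lemma expect_almost_additive k l G u w : almost_additive l G ->
  `|expect k (u ++ w) G - expect k u G - expect k w G| <= l.
Proof.
move=> hG; rewrite expect_cat -addrA -opprD -expect_const_cat -expectB.
apply: expect_abs_le => u' _; rewrite -expectB; apply: expect_abs_le => w' _.
by rewrite opprD addrA; exact: hG.
Qed.

Lemma expect_almost_additive_sum k l G w : 0 <= l -> almost_additive l G ->
  G [::] = 0 ->
  `|expect k w G - \sum_(x <- w) expect k [:: x] G| <= l * (size w)%:R.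
Proof.
move=> l0 hG G0; elim: w => [|x w IH].
  rewrite big_nil subr0 mulr0.
  suff -> : expect k [::] G = 0 by rewrite normr0.
  by elim: k.
rewrite big_cons -cat1s /= -natr1 mulrDr mulr1.
have := expect_almost_additive k [:: x] w hG; rewrite /=.
move: IH; move: (\sum_(_ <- _) _) => d.
move: (expect k (x :: w) G) (expect k w G) (expect k [:: x] G) => a b c.
rewrite !ler_norml => /andP[? ?] /andP[? ?]; lra.
Qed.

(** * Second moment over independent blocks *)

Section second_moment.
Variables (k : nat) (l eta : R) (G : word -> R).
Hypothesis l_ge0 : 0 <= l.
Hypothesis G_additive : almost_additive l G.
Hypothesis G_size : forall u, `|G u| <= (size u)%:R.
Hypothesis G_mean : forall x, `|expect k [:: x] G| + l <= eta.
Local Notation L := ((iter_len k la)%:R : R).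

Lemma G_nil : G [::] = 0.
Proof. by apply/eqP; rewrite -normr_le0; exact: (G_size [::]). Qed.

(** Each block contributes its own mean and one seam of cost [l]; [eta] bounds the two together. *)
Lemma mean_le w : `|expect k w G| <= eta * (size w)%:R.
Proof.
have h := expect_almost_additive_sum k w l_ge0 G_additive G_nil.
have h2 : `|\sum_(x <- w) expect k [:: x] G| <= (eta - l) * (size w)%:R.
  elim: w {h} => [|x w IH]; first by rewrite big_nil normr0 mulr0.
  rewrite big_cons /= -natr1 mulrDr mulr1.
  have := G_mean x.
  have := ler_normD (expect k [:: x] G) (\sum_(x <- w) expect k [:: x] G).
  by move: IH; set a := `|_|; lra.
move: h h2; rewrite mulrBl !ler_norml => /andP[? ?] /andP[? ?].
by apply/andP; split; lra.
Qed.

(** The cross term [2 * a * b] is kept exact, without absolute values, so that its mean can later be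
    factored by independence. *)
Lemma sqr_almost_add (a b c e1 e2 : R) : `|c - a - b| <= l -> `|a| <= e1 -> `|b| <= e2 ->
  c ^+ 2 <= a ^+ 2 + b ^+ 2 + 2 * a * b + (2 * l * (e1 + e2) + l ^+ 2).
Proof.
set d := c - a - b => hd ha hb.
have -> : c = a + b + d by rewrite /d; ring.
have hdd : d ^+ 2 <= l ^+ 2.
  by rewrite -real_normK ?num_real// ler_sqr ?nnegrE.
have hab : `|a + b| <= e1 + e2 by exact: le_trans (ler_normD _ _) (lerD ha hb).
have : d * (a + b) <= l * (e1 + e2).
  apply: le_trans (ler_norm _) _; rewrite normrM; exact: ler_pM.
nra.
Qed.

Lemma iter_lenw_le_la w : (iter_lenw k w <= size w * iter_len k la)%N.
Proof.
elim: w => //= x w IH; rewrite /iter_lenw /= -/(iter_lenw k w).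
by have := iter_len_le_la k x; lia.
Qed.

Lemma expect_mul_cat u w F F' :
  expect k u (fun u' => expect k w (fun w' => F u' * F' w')) =
  expect k u F * expect k w F'.
Proof.
rewrite mulrC -expectZ; apply: expect_eq => u' _; rewrite expectZ; exact: mulrC.
Qed.

(** Induction on the blocks. By independence the cross term has mean equal to a product of two
    means, at most [eta * (eta * q)]; hence the part quadratic in the number of blocks has
    [eta ^+ 2 + l * L] where the trivial bound has [L ^+ 2]. *)
Lemma second_moment_le w : expect k w (fun u => G u ^+ 2) <=
  (size w)%:R * (L + l) ^+ 2 + (size w)%:R ^+ 2 * (eta ^+ 2 + l * L).
Proof.
elim: w => [|x w IH] /=.
  have -> : expect k [::] (fun u => G u ^+ 2) = 0.
    elim: (k) => //=; by rewrite G_nil expr2 mulr0.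
  by rewrite expr0n /= !mul0r addr0.
set q := (size w)%:R in IH *.
have L0 : 0 <= L by [].
have step : expect k (x :: w) (fun u => G u ^+ 2) <=
    L ^+ 2 + expect k w (fun u => G u ^+ 2) + 2 * (expect k [:: x] G * expect k w G) +
    (2 * l * (L + q * L) + l ^+ 2).
  (* Every term of the bound becomes a nested mean, over the image of [x] and then over that of [w],
     which leaves a pointwise inequality. *)
  rewrite -cat1s expect_cat -expect_mul_cat -expectZ -[L ^+ 2](expect_const k [:: x]).
  rewrite -[X in _ + X + _ + _](expect_const k [:: x]) -expectD -expectD.
  rewrite -[X in _ + X](expect_const k [:: x]) -expectD.
  apply: expect_le => u su; rewrite -expectZ.
  rewrite -[L ^+ 2](expect_const k w) -!expectD -[X in _ + X](expect_const k w) -expectD.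
  apply: expect_le => v sv.
  have hu : `|G u| <= L.
    apply: le_trans (G_size _) _; rewrite su /iter_lenw /= addn0 ler_nat.
    exact: iter_len_le_la.
  have hv : `|G v| <= q * L.
    apply: le_trans (G_size _) _; rewrite sv /q -natrM ler_nat.
    exact: iter_lenw_le_la.
  have := sqr_almost_add (G_additive u v) hu hv.
  have hu2 : G u ^+ 2 <= L ^+ 2.
    by rewrite -real_normK ?num_real// ler_sqr ?nnegrE.
  lra.
have q0 : 0 <= q by rewrite /q.
have eta0 : 0 <= eta.
  by apply: le_trans _ (G_mean la); apply: addr_ge0.
have hM : expect k [:: x] G * expect k w G <= eta * (eta * q).
  apply: le_trans (ler_norm _) _; rewrite normrM; apply: ler_pM => //.
    by apply: le_trans _ (G_mean x); rewrite lerDl.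
  exact: mean_le.
apply: le_trans step _; rewrite -natr1 -/q.
have : 0 <= eta ^+ 2 by exact: sqr_ge0.
have : 0 <= l * L by exact: mulr_ge0.
have : 0 <= l ^+ 2 by exact: sqr_ge0.
move: IH hM; rewrite !expr2; nra.
Qed.

End second_moment.
(** Rounds the position [t] down to a block boundary, at a cost of at most one block. *)
Lemma iter_lenw_split k w t : (t <= iter_lenw k w)%N -> exists w1 w2,
  [/\ w = w1 ++ w2, (iter_lenw k w1 <= t)%N & (t <= iter_lenw k w1 + iter_len k la)%N].
Proof.
elim: w t => [|x w IH] t tw; first by exists [::], [::]; split => //; lia.
have [h|h] := ltnP t (iter_len k x).
  by exists [::], (x :: w); split => //;
     have := iter_len_le_la k x; rewrite /iter_lenw /=; lia.
have [|w1 [w2 [-> h1 h2]]] := IH (t - iter_len k x)%N.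
  by move: tw; rewrite /iter_lenw /= -/(iter_lenw k w); lia.
by exists (x :: w1), w2; split => //; rewrite /iter_lenw /= -/(iter_lenw k w1); lia.
Qed.

Lemma expect_size k w : expect k w (fun u => (size u)%:R) = (iter_lenw k w)%:R.
Proof. by rewrite -[RHS](expect_const k w); apply: expect_eq => u ->. Qed.

Lemma expectS1 k x F :
  expect k.+1 [:: x] F = \sum_i p i * expect k (zeta_letter i x) F.
Proof. by rewrite /=; under eq_bigr do rewrite cats0. Qed.

Lemma average_dist_le (a : 'I_m.+1 -> R) c d :
  (forall i, `|a i - c| <= d) -> `|\sum_i p i * a i - c| <= d.
Proof.
move=> h; have -> : \sum_i p i * a i - c = \sum_i p i * (a i - c).
  under [RHS]eq_bigr do rewrite mulrBr.
  by rewrite sumrB -mulr_suml p_sum1 mul1r.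
apply: le_trans (ler_norm_sum _ _ _) _.
rewrite -[d]mul1r -[X in X * d]p_sum1 mulr_suml; apply: ler_sum => i _.
by rewrite normrM ger0_norm// ler_wpM2l.
Qed.

(** * Bounded centred means on single blocks *)

Section discrepancy.
Variable v : seq bool.
Local Notation l := ((size v)%:R : R).
Local Notation occR := (fun u : word => (occ v u)%:R : R).

Lemma occ_almost_additive : almost_additive l occR.
Proof.
move=> u w; have h1 := occ_cat_ge v u w; have h2 := occ_cat_le v u w.
have -> : (occ v (u ++ w))%:R - (occ v u)%:R - (occ v w)%:R =
   (occ v (u ++ w) - occ v u - occ v w)%N%:R :> R.
  by rewrite !natrB//; lia.
by rewrite ger0_norm// ler_nat; lia.
Qed.

Definition mean_occ k x : R := expect k [:: x] occR.

Lemma mean_occ_lb k : mean_occ k.+1 lb = mean_occ k la.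
Proof.
rewrite /mean_occ expectS1 (eq_bigr (fun i => p i * mean_occ k la))//.
by rewrite -mulr_suml p_sum1 mul1r.
Qed.

(** Whatever the choice [i], the image of a has [m] letters a and one letter b; only the seams, one
    for each of its [m.+1] letters, depend on [i]. *)
Lemma mean_occ_la k :
  `|mean_occ k.+1 la - (m%:R * mean_occ k la + mean_occ k lb)| <= l * m.+1%:R.
Proof.
rewrite {1}/mean_occ expectS1; apply: average_dist_le => i.
have := expect_almost_additive_sum k (zeta_letter i la) (ler0n R _)
  occ_almost_additive erefl.
have -> : \sum_(x <- zeta_letter i la) expect k [:: x] occR =
    m%:R * mean_occ k la + mean_occ k lb.
  rewrite /zeta_letter /= big_cat big_cons !big_nseq !iter_addr_0.
  have im : (i <= m)%N by rewrite -ltnS.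
  by rewrite /= addrCA -mulrnDr (subnKC im) addrC mulr_natl.
by rewrite size_zeta_letter.
Qed.

(** Mean counts and lengths obey the same recursion, up to seams, and its matrix has determinant -1:
    each step flips the sign of the expression and adds at most a multiple of [iter_len k la]. *)
Lemma discrepancy_le k :
  `|mean_occ k lb * (iter_len k la)%:R - mean_occ k la * (iter_len k lb)%:R| <=
  (l * m.+1%:R + 1) * (iter_len k.+1 la)%:R.
Proof.
elim: k => [|k IH].
  (* At [k = 0] the expression is a difference of two indicators, covered by the summand 1 of the
     constant. *)
  rewrite /mean_occ /= !mulr1 addn0.
  have h x : (occ v [:: x] <= 1)%N := occ_le_size v [:: x].
  have h1 : `|(prefix v [:: lb])%:R - (prefix v [:: la])%:R| <= 1 :> R.
    by do 2 case: (prefix v _); rewrite ?subrr ?subr0 ?sub0r ?normrN ?normr1 ?normr0.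
  rewrite -![in leLHS]/(occ v [:: _]) in h *.
  have : 1 <= l * m.+1%:R + 1 by rewrite lerDr mulr_ge0.
  have : 1 <= (m * 1 + 1)%:R :> R by rewrite ler1n; lia.
  rewrite /= !addn0; nra.
have hd := mean_occ_la k.
set d := mean_occ k.+1 la - _ in hd.
have -> : mean_occ k.+1 lb * (iter_len k.+1 la)%:R -
    mean_occ k.+1 la * (iter_len k.+1 lb)%:R
  = - (mean_occ k lb * (iter_len k la)%:R - mean_occ k la * (iter_len k lb)%:R)
    - d * (iter_len k la)%:R.
  by rewrite mean_occ_lb /d /= natrD natrM; ring.
have h1 : `|d * (iter_len k la)%:R| <= (l * m.+1%:R + 1) * (iter_len k la)%:R.
  rewrite normrM (ger0_norm (ler0n _ _)) ler_wpM2r//.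
  by apply: le_trans hd _; rewrite lerDl.
apply: le_trans (ler_normB _ _) _; rewrite normrN.
apply: le_trans (lerD IH h1) _; rewrite -mulrDr ler_wpM2l//.
(* As [iter_len k.+2 la] equals [m * iter_len k.+1 la + iter_len k la] and [m] is positive, it
   absorbs both lengths, so the constant does not grow with [k]. *)
by rewrite -natrD ler_nat [leqRHS]/=; have := iter_len_lb_le k; rewrite /=; nia.
Qed.

Definition centred (c : R) (u : word) : R := (occ v u)%:R - c * (size u)%:R.

Lemma centred_almost_additive c : almost_additive l (centred c).
Proof.
move=> u w; rewrite /centred size_cat natrD.
have := occ_almost_additive u w; congr (`|_| <= _); ring.
Qed.

Lemma centred_size c u : 0 <= c <= 1 -> `|centred c u| <= (size u)%:R.
Proof.
move=> /andP[c0 c1]; rewrite /centred.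
have h1 : (occ v u)%:R <= (size u)%:R :> R by rewrite ler_nat occ_le_size.
have h0 : 0 <= (occ v u)%:R :> R by [].
have h2 : 0 <= (size u)%:R :> R by [].
rewrite ler_norml; apply/andP; split; nra.
Qed.

(** The order of quantifiers matters: [c] may vary with [k], but [eta] may not, since [k] will be
    chosen large in terms of [eta]. *)
Lemma centred_mean_bounded : exists eta : R, 0 <= eta /\ forall k, exists2 c,
  0 <= c <= 1 & forall x, `|expect k [:: x] (centred c)| + l <= eta.
Proof.
exists ((l * m.+1%:R + 1) * m.+1%:R + l); split.
  by rewrite addr_ge0// mulr_ge0// addr_ge0// mulr_ge0.
move=> k; set L : R := (iter_len k la)%:R.
have L0 : 0 < L by rewrite ltr0n iter_len_gt0.
have meanE c x : expect k [:: x] (centred c) = mean_occ k x - c * (iter_len k x)%:R.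
  by rewrite /centred expectB expectZ expect_size /iter_lenw /= addn0.
(* This [c] makes the mean on the image of a vanish; on the image of b the mean is then the
   discrepancy divided by [L], and [iter_len_la_leS] supplies the second factor [m.+1] of [eta]. *)
exists (mean_occ k la / L).
  apply/andP; split.
    rewrite divr_ge0 ?ler0n// -(expect_const k [:: la] 0).
    by apply: expect_le => u _.
  rewrite ler_pdivrMr// mul1r.
  have -> : L = expect k [:: la] (fun u => (size u)%:R).
    by rewrite expect_size /iter_lenw /= addn0.
  by apply: expect_le => u _; rewrite ler_nat occ_le_size.
move=> x; rewrite meanE lerD2r; case: x.
  have -> : mean_occ k true - mean_occ k la / L * (iter_len k true)%:R =
    (mean_occ k lb * L - mean_occ k la * (iter_len k lb)%:R) / L.
    by rewrite /lb; field; rewrite gt_eqF.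
  rewrite normrM normfV (ger0_norm (ltW L0)) ler_pdivrMr//.
  apply: le_trans (discrepancy_le k) _; rewrite -mulrA ler_wpM2l//.
  by rewrite -natrM ler_nat iter_len_la_leS.
rewrite -/la -/L divfK ?gt_eqF// subrr normr0.
by rewrite mulr_ge0// addr_ge0// mulr_ge0.
Qed.

End discrepancy.

(** * Concentration of the count on windows *)

Section window.
Variables (l : R) (G : word -> R).
Hypothesis l_ge0 : 0 <= l.
Hypothesis G_additive : almost_additive l G.
Hypothesis G_size : forall u, `|G u| <= (size u)%:R.

(** Here [z1] consists of whole blocks and ends shortly before the window does. The window arises
    from [z1] by deleting a head and adding a tail, both of length at most [L]; each changes [G] by
    at most [l + L]. *)
Lemma window_sqr_le (z1 z2 : word) (j n L : nat) :
  (j <= L)%N -> (j <= size z1 <= j + n)%N -> (j + n <= size z1 + L)%N ->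
  (j + n <= size (z1 ++ z2))%N ->
  G (take n (drop j (z1 ++ z2))) ^+ 2 <= 2 * G z1 ^+ 2 + 2 * (2 * l + 2 * L%:R) ^+ 2.
Proof.
move=> jL /andP[j1 j2] j3 j4.
rewrite drop_cat; have -> : (if (j < size z1)%N then drop j z1 ++ z2
    else drop (j - size z1) z2) = drop j z1 ++ z2.
  case: ltnP => // h; have -> : j = size z1 by lia.
  by rewrite subnn drop0 drop_size.
have -> : take n (drop j z1 ++ z2) = drop j z1 ++ take (n - (size z1 - j)) z2.
  rewrite take_cat size_drop; case: ltnP => // h.
  have -> : (n = size z1 - j)%N by lia.
  by rewrite subnn take0 cats0 -size_drop take_size.
set r := take _ _.
have h1 := G_additive (take j z1) (drop j z1); rewrite cat_take_drop in h1.
have h2 := G_additive (drop j z1) r.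
have h3 : `|G (take j z1)| <= L%:R.
  by apply: le_trans (G_size _) _; rewrite ler_nat size_take; case: ifP; lia.
have h4 : `|G r| <= L%:R.
  apply: le_trans (G_size _) _; rewrite ler_nat /r size_take.
  by case: ifP; lia.
move: h1 h2 h3 h4; rewrite !ler_norml.
move=> /andP[a1 a2] /andP[a3 a4] /andP[a5 a6] /andP[a7 a8].
move: (G (drop j z1 ++ r)) (G z1) (G (drop j z1)) (G r) (G (take j z1))
  a1 a2 a3 a4 a5 a6 a7 a8 => x y d t s *.
have : - (2 * l + 2 * L%:R) <= x - y <= 2 * l + 2 * L%:R by apply/andP; split; lra.
move: (2 * l + _) => e /andP[e1 e2].
(* This is [x ^+ 2 <= 2 * y ^+ 2 + 2 * (x - y) ^+ 2] in disguise. *)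
have : 0 <= (x - 2 * y) ^+ 2 by exact: sqr_ge0.
have : (x - y) ^+ 2 <= e ^+ 2.
  by rewrite -real_normK ?num_real// ler_sqr ?nnegrE ?ler_norml ?e1 ?e2//; lra.
rewrite !expr2; lra.
Qed.

(** The window is compared with the image of the longest suitable prefix [w1] of [w], and [q] is the
    number of its letters. That image has length at most [j + n <= 2 * n], and each of its blocks
    has length at least [iter_len k lb]. *)
Lemma window_second_moment_le k eta w j n :
  (forall x, `|expect k [:: x] G| + l <= eta) -> size w = n -> (iter_len k la <= n)%N ->
  (j < iter_len k (head la w))%N ->
  exists2 q : nat, (q * iter_len k lb <= 2 * n)%N &
  expect k w (fun z => G (take n (drop j z)) ^+ 2) <=
    2 * (q%:R * ((iter_len k la)%:R + l) ^+ 2 +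
         q%:R ^+ 2 * (eta ^+ 2 + l * (iter_len k la)%:R)) +
    2 * (2 * l + 2 * (iter_len k la)%:R) ^+ 2.
Proof.
move=> Gm sw Ln jw.
have jL : (j <= iter_len k la)%N.
  exact: leq_trans (ltnW jw) (iter_len_le_la _ _).
have jnw : (j + n <= iter_lenw k w)%N.
  move: jw Ln; rewrite -sw; case: (w) => [|x u] /=.
    by have := iter_len_gt0 k la; lia.
  by have := size_le_iter_lenw k u; rewrite /iter_lenw /= -/(iter_lenw k u); lia.
have [w1 [w2 [ww h1 h2]]] := iter_lenw_split jnw.
exists (size w1).
  suff : (size w1 * iter_len k lb <= iter_lenw k w1)%N by lia.
  elim: (w1) => //= x u IH; rewrite /iter_lenw /= -/(iter_lenw k u).
  have h : (iter_len k lb <= iter_len k x)%N by case: x => //; exact: iter_len_lb_le.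
  by rewrite mulSn; lia.
have hS := second_moment_le l_ge0 G_additive G_size Gm w1.
apply: le_trans (_ : expect k w1 (fun z => 2 * G z ^+ 2 +
  2 * (2 * l + 2 * (iter_len k la)%:R) ^+ 2) <= _); last first.
  by rewrite expectD expectZ expect_const lerD2r ler_wpM2l.
rewrite ww expect_cat; apply: expect_le => z1 s1.
rewrite -[leRHS](expect_const k w2); apply: expect_le => z2 s2.
apply: window_sqr_le; rewrite ?s1//; try by apply/andP; split; lia.
by rewrite size_cat s1 s2 -iter_lenw_cat -ww.
Qed.

End window.

(** With [q] of order [n / L], the three terms are of order [n * L], [n ^+ 2 / L] and [L ^+ 2]. The
    last three hypotheses make each at most a third of the bound: first [L] is taken large, then
    [n]. *)
Lemma window_bound_arith (eps l eta q L n B : R) :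
  0 < eps -> 0 <= l -> 0 <= eta -> 0 <= q -> 0 <= B -> 1 <= L -> L <= n ->
  q * L <= B * n -> l <= L -> eta ^+ 2 <= L ->
  6 * B ^+ 2 * (1 + l) <= eps * L -> 24 * B * L <= eps * n -> 96 * L <= eps * n ->
  2 * (q * (L + l) ^+ 2 + q ^+ 2 * (eta ^+ 2 + l * L)) + 2 * (2 * l + 2 * L) ^+ 2
  <= eps * n ^+ 2.
Proof.
move=> e0 l0 t0 q0 B0 L1 Ln qL lL tL h1 h2 h3.
have L0 : 0 < L by lra.
have n0 : 0 < n by lra.
have s1 : (L + l) ^+ 2 <= 4 * L ^+ 2 by rewrite !expr2; nra.
have a1 : q * (L + l) ^+ 2 <= 4 * (B * n * L).
  apply: le_trans (ler_wpM2l q0 s1) _.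
  have -> : q * (4 * L ^+ 2) = 4 * (q * L * L) by ring.
  by rewrite ler_pM2l// ler_pM2r.
have a2 : q ^+ 2 * (eta ^+ 2 + l * L) <= eps * n ^+ 2 / 6.
  apply: le_trans (_ : q ^+ 2 * (L * (1 + l)) <= _).
    by rewrite ler_wpM2l ?sqr_ge0//; lra.
  rewrite -(ler_pM2r L0).
  have -> : q ^+ 2 * (L * (1 + l)) * L = (q * L) ^+ 2 * (1 + l) by ring.
  apply: le_trans (_ : (B * n) ^+ 2 * (1 + l) <= _).
    have l1 : 0 <= 1 + l by lra.
    rewrite ler_wpM2r// ler_sqr// nnegrE mulr_ge0//; lra.
  have -> : (B * n) ^+ 2 * (1 + l) = (6 * B ^+ 2 * (1 + l)) * (n ^+ 2 / 6) by field.
  have -> : eps * n ^+ 2 / 6 * L = (eps * L) * (n ^+ 2 / 6) by field.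
  by rewrite ler_wpM2r// divr_ge0// sqr_ge0.
have a3 : (2 * l + 2 * L) ^+ 2 <= eps * n ^+ 2 / 6.
  apply: le_trans (_ : 16 * (L * L) <= _); first by rewrite !expr2; nra.
  have : L * (96 * L) <= n * (eps * n) by apply: ler_pM => //; lra.
  rewrite !expr2; lra.
have a4 : n * (24 * B * L) <= n * (eps * n) by rewrite ler_pM2l.
move: a1 a2 a3 a4; rewrite (expr2 n); set X := (L + l) ^+ 2; lra.
Qed.

Lemma window_concentration (v : word) (eps : R) : 0 < eps ->
  exists k n0 c, 0 <= c <= 1 /\ forall n w j, (n0 <= n)%N -> size w = n ->
  (j < iter_len k (head la w))%N ->
  expect k w (fun z => centred v c (take n (drop j z)) ^+ 2) <= eps * n%:R ^+ 2.
Proof.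
move=> e0; set l : R := (size v)%:R; have [eta [t0 heta]] := centred_mean_bounded v.
(* The factor 2 comes from [q * iter_len k lb <= 2 * n], the factor [m.+1] from [iter_len_la_le]. *)
set B : R := 2 * m.+1%:R.
(* Since [k <= iter_len k la], this makes [L] dominate all three summands. *)
pose k := (Num.truncn (l + eta ^+ 2 + 6 * B ^+ 2 * (1 + l) / eps)).+1.
set L : R := (iter_len k la)%:R.
have B0 : 0 <= B by rewrite mulr_ge0.
have l0 : 0 <= l by [].
have kL : l + eta ^+ 2 + 6 * B ^+ 2 * (1 + l) / eps <= L.
  apply: le_trans (ltW (truncnS_gt _)) _; rewrite ler_nat; exact: leq_iter_len.
have L1 : 1 <= L by rewrite ler1n iter_len_gt0.
have [c c01 hc] := heta k.
pose n0 := (Num.truncn (L + 24 * B * L / eps + 96 * L / eps)).+1.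
exists k, n0, c; split => // n w j nn sw jw.
have hn : L + 24 * B * L / eps + 96 * L / eps <= n%:R.
  by apply: le_trans (ltW (truncnS_gt _)) _; rewrite ler_nat.
have x1 : 0 <= eta ^+ 2 by exact: sqr_ge0.
have x2 : 0 <= 6 * B ^+ 2 * (1 + l) / eps.
  by rewrite divr_ge0 ?(ltW e0)// !mulr_ge0// ?sqr_ge0 ?addr_ge0.
have x3 : 0 <= 24 * B * L / eps by rewrite divr_ge0 ?(ltW e0)// !mulr_ge0.
have x4 : 0 <= 96 * L / eps by rewrite divr_ge0 ?(ltW e0)// mulr_ge0.
have Ln : L <= n%:R by lra.
have [|q hq] := window_second_moment_le l0 (centred_almost_additive v c)
  (fun u => centred_size v u c01) hc sw _ jw; first by rewrite -(ler_nat R).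
move=> h; apply: le_trans h _; apply: (@window_bound_arith _ _ _ _ _ _ B) => //.
- have : (q * iter_len k la <= 2 * m.+1 * n)%N.
    apply: leq_trans (leq_mul (leqnn q) (iter_len_la_le k)) _.
    by rewrite mulnCA -mulnA [leqRHS]mulnCA leq_mul2l hq orbT.
  by rewrite -(ler_nat R) !natrM.
- by rewrite -/L; lra.
- by rewrite -/L; lra.
- by rewrite [leRHS]mulrC -ler_pdivrMr//; move: kL; rewrite -/L; lra.
- by rewrite [leRHS]mulrC -ler_pdivrMr//; move: hn; rewrite -/L; lra.
- by rewrite [leRHS]mulrC -ler_pdivrMr//; move: hn; rewrite -/L; lra.
Qed.

End expectation.

(** * The induced substitution matrix *)

Section legality.
Variable m : nat.

Lemma zeta_word_cons i (c : seq 'I_m.+1) x w :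
  zeta_word (i :: c) (x :: w) = zeta_letter i x ++ zeta_word c w.
Proof. by []. Qed.

Lemma zeta_word_cat (c1 c2 : seq 'I_m.+1) w1 w2 : size c1 = size w1 ->
  zeta_word (c1 ++ c2) (w1 ++ w2) = zeta_word c1 w1 ++ zeta_word c2 w2.
Proof. by move=> h; rewrite /zeta_word zip_cat// map_cat flatten_cat. Qed.

Lemma size_zeta_word (c : seq 'I_m.+1) w : size c = size w ->
  size (zeta_word c w) = iter_lenw m 1 w.
Proof.
elim: w c => [|x w IH] [|i c] //= [/IH h].
rewrite zeta_word_cons size_cat h size_zeta_letter /iter_lenw /= /zeta_length.
by case: eqP => //= _; rewrite muln1 addn1.
Qed.

Lemma legal_infix w v : infix w v -> legal m v -> legal m w.
Proof.
by move=> wv [k [u [k0 iu vu]]]; exists k, u; split => //; exact: infix_trans vu.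
Qed.

Lemma legal_image (c : seq 'I_m.+1) w : size c = size w -> legal m w ->
  legal m (zeta_word c w).
Proof.
move=> cw [k [u [k0 iu /infixP[s [t us]]]]].
(* Outside the occurrence of [w] any choices will do. *)
pose c1 := nseq (size s) (ord0 : 'I_m.+1); pose c2 := nseq (size t) (ord0 : 'I_m.+1).
exists k.+1, (zeta_word (c1 ++ c ++ c2) u); split => //.
  exists u => //; exists (c1 ++ c ++ c2) => //.
  by rewrite us !size_cat !size_nseq cw.
rewrite us !zeta_word_cat ?size_nseq//; apply/infixP.
by exists (zeta_word c1 s), (zeta_word c2 t).
Qed.

Lemma zeta_length_iter_len x : zeta_length m x = iter_len m 1 x.
Proof. by rewrite /zeta_length /=; case: eqP => // _; rewrite muln1 addn1. Qed.

(** A window starting in the first block fits, because each of the other [n - 1] letters contributes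
    at least one letter to [z]. *)
Lemma size_window n w (z : word) k j : size w = n -> size z = iter_lenw m k w ->
  (j < iter_len m k (head la w))%N -> size (take n (drop j z)) = n.
Proof.
move=> sw sz jw; rewrite size_take size_drop sz.
case: ltnP => // h; apply/eqP; rewrite eqn_leq h /=.
move: jw {h}; rewrite -sw {sw sz}; case: w => [|x w] //= jw.
by have := size_le_iter_lenw m k w; rewrite /iter_lenw /= -/(iter_lenw m k w); lia.
Qed.

(** Ensures that every letter of an induced image is an index of the matrix, so that its columns
    miss no occurrence. *)
Lemma legal_induced n (c : seq 'I_m.+1) w x :
  size w = n -> size c = n -> legal m w -> x \in induced_image n c w ->
  legal m x /\ size x = n.
Proof.
move=> sw sc lw /mapP[k]; rewrite mem_iota /= add0n => kw ->; split.
  apply: (@legal_infix _ (zeta_word c w)).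
    apply/infixP; exists (take k (zeta_word c w)), (drop n (drop k (zeta_word c w))).
    by rewrite !cat_take_drop.
  by apply: legal_image => //; rewrite sc.
apply: (@size_window _ w _ 1) => //; first by rewrite size_zeta_word// sc.
by rewrite -zeta_length_iter_len.
Qed.

End legality.

Section induced.
Variables (R : realType) (m : nat) (p : 'I_m.+1 -> R).
Hypothesis p_ge0 : forall j, 0 <= p j.
Hypothesis p_sum1 : \sum_j p j = 1.
Local Notation expect := (expect p).
Local Notation expect1 := (expect1 p).

Lemma sum_tupleS (T : finType) n (F : n.+1.-tuple T -> R) :
  \sum_(t : n.+1.-tuple T) F t = \sum_(x : T) \sum_(t : n.-tuple T) F (cons_tuple x t).
Proof.
rewrite pair_big /=; apply: (reindex (fun q => cons_tuple q.1 q.2)); apply: onW_bij.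
exists (fun t : n.+1.-tuple T => (thead t, behead_tuple t)).
  by case=> x t /=; congr (_, _); apply: val_inj.
by move=> t /=; rewrite [RHS]tuple_eta; apply: val_inj.
Qed.

(** Links the recursive mean with the sum over choices that defines [induced_matrix]. *)
Lemma expect1_tuple n w F : size w = n ->
  expect1 w F =
  \sum_(c : n.-tuple 'I_m.+1) (\prod_(t < n) p (tnth c t)) * F (zeta_word c w).
Proof.
elim: n w F => [|n IH] [|x w] F //= => [_|[sw]].
  rewrite (big_pred1 [tuple]) ?big_ord0 ?mul1r//.
  by move=> c; rewrite /= (tuple0 c); apply/esym/eqP.
rewrite sum_tupleS; apply: eq_bigr => i _; rewrite (IH _ _ sw) mulr_sumr.
apply: eq_bigr => c _; rewrite big_ord_recl /= tnth0 mulrA; congr (_ * _ * _).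
by apply: eq_bigr => t _; rewrite tnthS.
Qed.

Section windows.
Variables (n : nat) (g : word -> R).
Hypothesis n_gt0 : (0 < n)%N.

(* As an operator on [g], this is the [k]-th power of the transpose of the induced
   matrix: only the windows starting in the image of the first letter count. *)
Definition window_sum k w : R :=
  expect k w (fun z => \sum_(j < iter_len m k (head la w)) g (take n (drop j z))).

(** The blocks of the letters of [u] tile the image of [u], so summing over first blocks reaches
    each window starting there once. The hypothesis gives every position of [u] a full window of [n]
    letters. *)
Lemma window_sum_cat k u v : (n <= (size v).+1)%N ->
  \sum_(j < size u) window_sum k (take n (drop j (u ++ v))) =
  expect k (u ++ v) (fun z => \sum_(j < iter_lenw m k u) g (take n (drop j z))).
Proof.
elim: u => [|y u IH] nv.
  rewrite big_ord0 -[LHS](expect_const p_ge0 p_sum1 k ([::] ++ v)).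
  by apply: expect_eq => // z _; rewrite big_ord0.
rewrite big_ord_recl drop0 -[iter_lenw m k (y :: u)]/(iter_len m k y + iter_lenw m k u)%N.
rewrite (@expect_eq _ _ _ p_ge0 _ _ _ (fun z =>
    \sum_(j < iter_len m k y) g (take n (drop j z)) +
    \sum_(j < iter_lenw m k u) g (take n (drop (iter_len m k y + j) z)))); last first.
  by move=> z _; rewrite big_split_ord.
rewrite expectD//; congr (_ + _).
  (* Windows starting in the block of [y] stay within the image of the first [n] letters; the image
     of the rest averages out. *)
  rewrite -[in RHS](cat_take_drop n (_ ++ v)) expect_cat// /window_sum.
  have -> : head la (take n ((y :: u) ++ v)) = y by case: (n) n_gt0.
  set t := take n _; have st : size t = n.
    by rewrite size_takel// size_cat /=; lia.
  have ht : head la t = y by rewrite /t; case: (n) n_gt0.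
  apply: expect_eq => // z sz.
  rewrite -[LHS](expect_const p_ge0 p_sum1 k (drop n (y :: u ++ v))).
  apply: expect_eq => // z' _; apply: eq_bigr => j _.
  have := @size_window m n t z k j st sz; rewrite ht => /(_ (ltn_ord j)).
  rewrite size_take size_drop => h.
  rewrite drop_cat; case: ltnP => jz; last first.
    by move: h n_gt0 jz; case: ifP; lia.
  rewrite take_cat size_drop; case: ltnP => //; move: h; case: ifP; first by lia.
  move=> _ h _; rewrite h subnn take0 cats0.
  by rewrite take_oversize// size_drop h.
rewrite -[in RHS](cat1s y) -catA expect_cat//.
rewrite -[LHS](expect_const p_ge0 p_sum1 k [:: y]); apply: expect_eq => // z sz.
apply: etrans (IH nv) _; apply: expect_eq => // z' _; apply: eq_bigr => j _.
rewrite drop_cat sz /iter_lenw /= addn0.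
by rewrite ltnNge leq_addr /= addKn.
Qed.

End windows.

(** On the level of means, inducing on words of length [n] commutes with taking powers of the
    substitution. *)
Lemma window_sum_comp n g k w : (0 < n)%N -> size w = n ->
  window_sum n (window_sum n g k) 1 w = window_sum n g k.+1 w.
Proof.
move=> n0 sw; rewrite /window_sum -zeta_length_iter_len.
case: w sw => [|x w] sw; first by move: n0; rewrite -sw.
rewrite /=; apply: eq_bigr => i _; congr (_ * _); apply: expect1_eq => // v hv.
rewrite -(size_zeta_letter i x) window_sum_cat//.
  by rewrite iter_lenw_zeta_letter.
have := hv 0; rewrite iter_lenw0 => ->; have := size_le_iter_lenw m 1 w.
by move: sw => /= <-.
Qed.

Lemma window_sum_const n k w : window_sum n (fun=> 1) k w = (iter_len m k (head la w))%:R.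
Proof.
rewrite /window_sum -[RHS](expect_const p_ge0 p_sum1 k w); apply: expect_eq => // z _.
by rewrite sumr_const card_ord.
Qed.

(** * The Perron-Frobenius eigenvector as a stationary average *)

Section eigenvector.
Variables (n : nat) (v : 'cV[R]_#|legal_words m n|) (lam : R).
Hypothesis n_gt0 : (0 < n)%N.
Hypothesis v_eigen : induced_matrix p n *m v = lam *: v.
Hypothesis v_gt0 : forall i, 0 < v i 0.
Hypothesis v_sum1 : \sum_i v i 0 = 1.
Local Notation nu g := (\sum_i v i 0 * g (enum_val i : word)).

Lemma enum_val_legal (i : 'I_#|legal_words m n|) : legal m (enum_val i).
Proof. by have := enum_valP i; rewrite inE => /asboolP. Qed.

Lemma sum_count_legal (g : word -> R) s :
  (forall x, x \in s -> legal m x /\ size x = n) ->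
  \sum_(i < #|legal_words m n|) (count_mem (enum_val i : word) s)%:R * g (enum_val i) =
  \sum_(x <- s) g x.
Proof.
elim: s => [|x s IH] hs.
  by rewrite big_nil big1// => i _; rewrite mul0r.
rewrite big_cons -IH => [|y ys]; last by apply: hs; rewrite in_cons ys orbT.
have [lx sx] := hs x (mem_head _ _).
have sx' : size x == n by rewrite sx.
have xl : Tuple sx' \in legal_words m n by rewrite inE; apply/asboolP.
under eq_bigr do rewrite /= natrD mulrDl.
rewrite big_split /=; congr (_ + _).
rewrite (bigD1 (enum_rank_in xl (Tuple sx')))//= enum_rankK_in//= eqxx mul1r.
rewrite big1 ?addr0// => i hi.
case: eqP => [xi|]; last by rewrite mul0r.
case/eqP: hi; apply: enum_val_inj; rewrite enum_rankK_in//; exact: val_inj.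
Qed.

(** The eigenvector equation paired with the test function [g], the matrix being moved to the side
    of [g]. *)
Lemma eigen_window_sum g : lam * nu g = nu (window_sum n g 1).
Proof.
rewrite mulr_sumr.
under eq_bigr => i _.
  have -> : lam * (v i 0 * g (enum_val i)) =
      (induced_matrix p n *m v) i 0 * g (enum_val i).
    by rewrite v_eigen mxE mulrA.
  rewrite mxE mulr_suml; over.
rewrite exchange_big /=; apply: eq_bigr => j _.
rewrite /window_sum -zeta_length_iter_len /=.
rewrite (expect1_tuple _ (size_tuple (enum_val j))) mulr_sumr.
under eq_bigr do rewrite mxE !mulr_suml.
rewrite exchange_big /=; apply: eq_bigr => c _.
set P := \prod_(t < n) _.
transitivity (\sum_(i < #|legal_words m n|) (v j 0 * P) * ((count_mem (enum_val i : word)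
    (induced_image n c (enum_val j)))%:R * g (enum_val i))).
  by apply: eq_bigr => i _; ring.
rewrite -mulr_sumr sum_count_legal; last first.
  move=> x; apply: legal_induced; rewrite ?size_tuple//; exact: enum_val_legal.
rewrite big_map -mulrA.
congr (_ * (_ * _)).
by rewrite -[RHS](big_mkord xpredT (fun k => g (take n (drop k _)))) /index_iota subn0.
Qed.

Lemma iter_eigen_window_sum g k : lam ^+ k * nu g = nu (window_sum n g k).
Proof.
elim: k => [|k IH].
  rewrite mul1r; apply: eq_bigr => i _; congr (_ * _).
  by rewrite /window_sum /= big_ord_recl big_ord0 drop0 addr0 take_oversize ?size_tuple.
rewrite exprS -mulrA IH eigen_window_sum; apply: eq_bigr => i _; congr (_ * _).
by apply: window_sum_comp => //; rewrite size_tuple.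
Qed.

(** After [k] substitution steps [nu g] is a weighted average of means over windows starting in the
    first block; the normalisation [lam ^+ k] is the value obtained for [g = 1]. *)
Lemma eigenvector_average_le g (e : R) k :
  (forall w j, size w = n -> (j < iter_len m k (head la w))%N ->
    expect k w (fun z => g (take n (drop j z))) <= e) ->
  nu g <= e.
Proof.
move=> h.
(* For [g = 1] the equation expresses [lam] as the average length of the image of the first
   letter. *)
have lam1 : 1 <= lam.
  have := iter_eigen_window_sum (fun=> 1) 1.
  under eq_bigr do rewrite mulr1.
  rewrite v_sum1 mulr1 expr1 => ->; rewrite -[X in X <= _]v_sum1.
  apply: ler_sum => i _; rewrite ler_peMr// ?(ltW (v_gt0 i))//.
  by rewrite window_sum_const ler1n iter_len_gt0.
have lamk : 0 < lam ^+ k by rewrite exprn_gt0//; exact: lt_le_trans lam1.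
rewrite -(ler_pM2l lamk) iter_eigen_window_sum.
have -> : lam ^+ k = nu (fun w => (iter_len m k (head la w))%:R).
  have := iter_eigen_window_sum (fun=> 1) k.
  under eq_bigr do rewrite mulr1.
  rewrite v_sum1 mulr1 => ->.
  by apply: eq_bigr => i _; rewrite window_sum_const.
rewrite mulr_suml; apply: ler_sum => i _; rewrite -mulrA ler_pM2l//.
rewrite /window_sum expect_sum//.
apply: le_trans (_ : \sum_(j < iter_len m k (head la (enum_val i))) e <= _).
  by apply: ler_sum => j _; apply: h; rewrite ?size_tuple.
by rewrite sumr_const card_ord mulr_natl.
Qed.

End eigenvector.
End induced.

(** * The hull and invariant sets *)

Section hull_cylinders.
Variable m : nat.
Local Notation X := (hull_space m).

Definition coord_set (i : int) (b : bool) : set X := [set x | (\val x : config) i = b].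

Lemma open_coord_set i b : open (coord_set i b).
Proof.
have cv : continuous (fun x : X => (\val x : config) i).
  move=> x; apply: (@continuous_comp X config bool (fun x => \val x) (fun f => f i)).
    exact: initial_continuous.
  exact: (@proj_continuous int (fun=> bool) i).
have -> : coord_set i b = (fun x : X => (\val x : config) i) @^-1` [set b] by [].
apply: open_comp; first by move=> x _; exact: cv.
exact: discrete_open.
Qed.

Lemma hull_cylinder_nil k : @hull_cylinder m k [::] = setT.
Proof. by apply/seteqP; split. Qed.

Lemma hull_cylinder_cons k b w :
  @hull_cylinder m k (b :: w) = coord_set k b `&` @hull_cylinder m (k + 1) w.
Proof.
apply/seteqP; split => x; rewrite /hull_cylinder /cylinder /coord_set /=.
  rewrite /mkseq /= -[1%N]/(1 + 0)%N iotaDl -map_comp addr0 => -[-> h]; split => //.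
  rewrite -[RHS]h; apply: eq_map => i /=; congr ((\val x : config) _).
  by rewrite -addrA.
rewrite /mkseq /= -[1%N]/(1 + 0)%N iotaDl -map_comp addr0 => -[-> h]; congr cons.
rewrite -[RHS]h; apply: eq_map => i /=; congr ((\val x : config) _).
by rewrite -addrA.
Qed.

Lemma measurable_hull_cylinder k w :
  measurable (@hull_cylinder m k w : set (hull_borel m)).
Proof.
elim: w k => [|b w IH] k; first by rewrite hull_cylinder_nil; exact: measurableT.
rewrite hull_cylinder_cons; apply: measurableI => //.
by apply: sub_sigma_algebra; exact: open_coord_set.
Qed.

Lemma shift_hull_cylinder k w :
  @shift_hull m @^-1` hull_cylinder k w = hull_cylinder (k + 1) w.
Proof.
elim: w k => [|b w IH] k; first by rewrite !hull_cylinder_nil.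
by rewrite !hull_cylinder_cons preimage_setI IH.
Qed.

(** Words of the wrong length give the empty set, so the family is indexed by the whole countable
    type [nat * word]. *)
Definition central_cylinder (n : nat) (w : word) : set X :=
  [set x | size w = n.*2 /\ hull_cylinder (- n%:Z) w x].

Definition central_word (n : nat) (x : X) : word :=
  mkseq (fun i => (\val x : config) (- n%:Z + i%:Z)) n.*2.

Lemma central_cylinder_refl n x : central_cylinder n (central_word n x) x.
Proof.
by split; rewrite /central_word ?size_mkseq// /hull_cylinder /cylinder /= size_mkseq.
Qed.

Lemma central_cylinderP n x y : central_cylinder n (central_word n x) y <->
  forall i : int, - n%:Z <= i < n%:Z -> (\val y : config) i = (\val x : config) i.
Proof.
split=> [[_]|h]; rewrite /hull_cylinder /cylinder /=.
  rewrite size_mkseq => h i hi.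
  have := congr1 (fun s => nth la s (absz (i + n%:Z))) h.
  rewrite /central_word !nth_mkseq; try lia.
  by have -> : - n%:Z + (absz (i + n%:Z))%:Z = i by lia.
split; first by rewrite size_mkseq.
rewrite /hull_cylinder /cylinder /= size_mkseq; apply/eq_in_map => i.
by rewrite mem_iota => /andP[_ hi]; apply: h; lia.
Qed.

Lemma central_cylinder_word n w x : central_cylinder n w x -> w = central_word n x.
Proof. by move=> [sw]; rewrite /hull_cylinder /cylinder /= sw. Qed.

Lemma central_cylinderE n w : central_cylinder n w =
  if size w == n.*2 then hull_cylinder (- n%:Z) w else set0.
Proof.
apply/seteqP; split => x; case: eqP => // h; first by case.
by case.
Qed.

(** Otherwise there are points outside [U] agreeing with [x] on ever larger central windows; they
    converge to [x] coordinatewise, against openness. *)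
Lemma central_cylinder_subset (U : set X) x : open U -> U x ->
  exists n, central_cylinder n (central_word n x) `<=` U.
Proof.
move=> [B oB BU] Ux; apply: contrapT => /forallNP h.
have {}h n : exists y, central_cylinder n (central_word n x) y /\ ~ U y.
  by have /existsNP[y /not_implyP] := h n; exists y.
have [y hy] := choice h.
have yx : (fun n => \val (y n) : config) @ \oo --> (\val x : config).
  apply/cvg_sup => i A /=.
  rewrite (@nbhsE (initial_topology (fun f : int -> bool => f i))).
  move=> [V [[W oW <-] /= Wx] VA].
  exists `|i|.+1 => // n /= ni; apply: VA => /=.
  by rewrite ((central_cylinderP n x (y n)).1 (hy n).1)//; lia.
have nB : nbhs (\val x : config) B.
  by apply: open_nbhs_nbhs; split => //; move: Ux; rewrite -BU.
have [N _ /(_ N (leqnn N))/= BN] := yx _ nB.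
by have [_] := hy N; apply; rewrite -BU.
Qed.

Lemma open_bigcup_central (U : set X) : open U ->
  U = \bigcup_(q in [set q : nat * word | central_cylinder q.1 q.2 `<=` U])
        central_cylinder q.1 q.2.
Proof.
move=> oU; apply/seteqP; split => x.
  move=> Ux; have [n hn] := central_cylinder_subset oU Ux.
  by exists (n, central_word n x) => //; exact: central_cylinder_refl.
by move=> [q /= qU] /qU.
Qed.

Definition central_cylinders : set (set X) :=
  range (fun q : nat * word => central_cylinder q.1 q.2).

(** Two central cylinders are nested or disjoint. *)
Lemma setI_closed_central_cylinders : setI_closed central_cylinders.
Proof.
suff main n1 n2 w1 w2 : (n1 <= n2)%N ->
    central_cylinders (central_cylinder n1 w1 `&` central_cylinder n2 w2).
  move=> _ _ [[n1 w1] _ <-] [[n2 w2] _ <-] /=.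
  by case: (leqP n1 n2) => [|/ltnW] h; last rewrite setIC; exact: main.
move=> n12; have [[x [x1 x2]]|h] := pselect
    (exists x, (central_cylinder n1 w1 `&` central_cylinder n2 w2) x).
  exists (n2, w2) => //=; rewrite setIidr//.
  move=> y; rewrite (central_cylinder_word x1) (central_cylinder_word x2).
  move=> /central_cylinderP hy; apply/central_cylinderP => i hi.
  by apply: hy; lia.
(* The empty word has the wrong length for [n = 1] and so represents the empty set. *)
exists (1%N, [::]) => //=; rewrite central_cylinderE /=.
by apply/seteqP; split => // x hx; apply: h; exists x.
Qed.

(** Open sets are countable unions of central cylinders, which thus form a generating pi-system for
    the Borel sets. *)
Lemma measurable_central_cylinders :
  @measurable _ (hull_borel m) = <<s central_cylinders >>.
Proof.
apply/seteqP; split; last first.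
  apply: smallest_sub; first exact: sigma_algebra_measurable.
  move=> _ [[n w] _ <-] /=; rewrite central_cylinderE; case: ifP => _ //.
  exact: measurable_hull_cylinder.
apply: smallest_sub; first exact: smallest_sigma_algebra.
move=> U oU; rewrite (open_bigcup_central oU) bigcup_mkcond.
apply: (@countable_bigcupT_measurable _ (g_sigma_algebraType central_cylinders)).
  exact: countableP.
move=> q; case: ifP => _; last exact: measurable0.
by apply: sub_sigma_algebra; exists q.
Qed.

Lemma measurable_shift_hull :
  measurable_fun setT (@shift_hull m : hull_borel m -> hull_borel m).
Proof.
apply: (@measurability _ _ (hull_borel m) (hull_borel m) _ _ central_cylinders).
  exact: measurable_central_cylinders.
move=> _ [_ [[n w] _ <-] <-]; rewrite setTI /= central_cylinderE.
case: ifP => _; last by rewrite preimage_set0.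
by rewrite shift_hull_cylinder; exact: measurable_hull_cylinder.
Qed.

End hull_cylinders.

(** * Cylinder frequencies relative to an invariant set *)

Section ergodicity.
Variables (R : realType) (m : nat).
Hypothesis m_gt0 : (0 < m)%N.
Variable p : 'I_m.+1 -> R.
Hypothesis p_ge0 : forall j, 0 <= p j.
Hypothesis p_sum1 : \sum_j p j = 1.
Variable mu : probability (hull_borel m) R.
Hypothesis mu_inv : invariant_measure mu (@shift_hull m).
Local Notation X := (hull_borel m).
Local Notation cyl := (@hull_cylinder m).

Definition pr (A : set X) : R := fine (mu A).

Lemma prE (A : set X) : measurable A -> mu A = (pr A)%:E.
Proof. by move=> mA; rewrite /pr fineK// fin_num_measure. Qed.

Lemma pr_ge0 (A : set X) : 0 <= pr A.
Proof. exact: fine_ge0. Qed.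

Lemma pr_le (A B : set X) : measurable A -> measurable B -> A `<=` B -> pr A <= pr B.
Proof.
by move=> mA mB AB; rewrite /pr fine_le ?fin_num_measure// le_measure ?inE.
Qed.

Lemma prT : pr setT = 1.
Proof. by rewrite /pr probability_setT. Qed.

Lemma pr_coord (A : set X) k : measurable A ->
  pr A = \sum_(b : bool) pr (A `&` @coord_set m k b).
Proof.
move=> mA.
have mc b : measurable (@coord_set m k b : set X).
  by apply: sub_sigma_algebra; exact: open_coord_set.
rewrite big_bool /= {1}/pr (@measureDI _ _ _ mu _ (@coord_set m k true))//.
have [mI mD] : measurable (A `&` @coord_set m k true) /\
    measurable (A `\` @coord_set m k true).
  by split; [exact: measurableI|exact: measurableD].
rewrite fineD ?fin_num_measure// addrC -!/(pr _); congr (_ + _); congr (pr _).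
apply/seteqP; split => x [Ax]; rewrite /coord_set /=; by case: (sval x k).
Qed.

Lemma pr_partition (A : set X) k n : measurable A ->
  pr A = \sum_(w : n.-tuple bool) pr (A `&` cyl k w).
Proof.
elim: n A k => [|n IH] A k mA.
  rewrite (big_pred1 [tuple]); first by rewrite hull_cylinder_nil setIT.
  by move=> w; rewrite /= (tuple0 w); apply/esym/eqP.
rewrite sum_tupleS (pr_coord k mA); apply: eq_bigr => b _.
rewrite (IH _ (k + 1)).
  by apply: eq_bigr => w _; rewrite -setIA -hull_cylinder_cons.
by apply: measurableI => //; apply: sub_sigma_algebra; exact: open_coord_set.
Qed.

Lemma pr_shift (A : set X) k w : measurable A -> @shift_hull m @^-1` A = A ->
  pr (A `&` cyl k w) = pr (A `&` cyl 0 w).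
Proof.
move=> mA sA.
have step j : pr (A `&` cyl (j + 1) w) = pr (A `&` cyl j w).
  rewrite /pr -(@mu_inv (A `&` cyl j w)); last first.
    by apply: measurableI => //; exact: measurable_hull_cylinder.
  by rewrite preimage_setI sA shift_hull_cylinder.
case: k => n.
  elim: n => [//|n IH]; rewrite -IH -[RHS]step; congr (pr (A `&` cyl _ w)); lia.
elim: n => [|n IH].
  by rewrite -[LHS]step; congr (pr (A `&` cyl _ w)); lia.
by rewrite -IH -[LHS]step; congr (pr (A `&` cyl _ w)); lia.
Qed.

Lemma cyl_prefix (v : word) (i n : nat) (w : n.-tuple bool) : (i + size v <= n)%N ->
  cyl i%:Z v `&` cyl 0 w = if prefix v (drop i w) then cyl 0 w else set0.
Proof.
move=> h.
have key x : cyl 0 w x -> cyl i%:Z v x <-> prefix v (drop i w).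
  rewrite /hull_cylinder /cylinder /= size_tuple => hw.
  have -> : prefix v (drop i w) =
      (mkseq (fun k => (\val x : config) (i%:Z + k%:Z)) (size v) == v).
    rewrite prefixE -hw /mkseq -map_drop -map_take drop_iota take_iota.
    have -> : minn (size v) (n - i) = size v by lia.
    by rewrite add0n -[X in iota X]addn0 iotaDl -map_comp.
  by split => [->|/eqP].
case: ifP => hp; apply/seteqP; split => x //=.
- by case.
- by move=> hw; split => //; apply/key.
- by case => hv hw; have := (key x hw).1 hv; rewrite hp.
Qed.

Lemma card_late_positions n c : (\sum_(i < n) (c <= i)%N = n - c)%N.
Proof.
elim: n => [|n IH]; first by rewrite big_ord0.
by rewrite big_ord_recr /= IH; case: leqP => h /=; lia.
Qed.

(** By invariance every start [i] with [i + size v <= n] contributes exactly [pr (A]&[cyl 0 v)]. At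
    the remaining starts, at most [size v] in number, [v] does not fit and the error is at most
    1. *)
Lemma occ_expectation (A : set X) (v : word) (n : nat) :
  measurable A -> @shift_hull m @^-1` A = A ->
  `|\sum_(w : n.-tuple bool) pr (A `&` cyl 0 w) * (occ v w)%:R
    - n%:R * pr (A `&` cyl 0 v)| <= (size v)%:R.
Proof.
move=> mA sA.
have -> : n%:R * pr (A `&` cyl 0 v) = \sum_(i < n) pr (A `&` cyl 0 v).
  by rewrite sumr_const card_ord mulr_natl.
under eq_bigr => w _ do rewrite (occE v (size_tuple w)) natr_sum mulr_sumr.
rewrite exchange_big /= -sumrB.
apply: le_trans (ler_norm_sum _ _ _) _.
apply: le_trans (_ : \sum_(i < n) ((n.+1 - size v <= i)%N : nat)%:R <= _); last first.
  by rewrite -natr_sum card_late_positions ler_nat; lia.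
apply: ler_sum => i _.
have mv j : measurable (A `&` cyl j v).
  by apply: measurableI => //; exact: measurable_hull_cylinder.
case: (leqP (n.+1 - size v) i) => hi; last first.
  rewrite -(pr_shift i%:Z v mA sA) (pr_partition 0 n (mv i%:Z)).
  rewrite (eq_bigr (fun w : n.-tuple bool => pr (A `&` cyl i%:Z v `&` cyl 0 w))).
    by rewrite subrr normr0.
  move=> w _; rewrite -setIA cyl_prefix; last by lia.
  by case: ifP => _; rewrite ?mulr1// mulr0 setI0 /pr measure0.
have [v0|v0] := leqP (size v) 0.
  by have := ltn_ord i; move: hi; lia.
rewrite big1; last first.
  move=> w _; suff -> : prefix v (drop i w) = false by rewrite mulr0.
  apply/negbTE/negP => /size_prefix hp.
  have : (size v <= n - i)%N by rewrite (leq_trans hp)// size_drop size_tuple.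
  by have := ltn_ord i; lia.
rewrite sub0r normrN ger0_norm ?pr_ge0// -prT pr_le//.
Qed.

Section against_eigenvectors.
Variable PF : forall l : nat, 'cV[R]_#|legal_words m l|.
Hypothesis PF_eigen : forall l : nat, (0 < l)%N ->
  right_PF_eigenvector (induced_matrix p l) (PF l).
Hypothesis mu_cylinder : forall (k : int) (l : nat) (w : l.-tuple bool)
  (hw : w \in legal_words m l), (0 < l)%N ->
  mu (cyl k w) = (PF l (enum_rank_in hw w) 0)%:E.

Lemma pr_legal_sum n (g : word -> R) : (0 < n)%N ->
  \sum_(w : n.-tuple bool | w \in legal_words m n) pr (cyl 0 w) * g w =
  \sum_i PF n i 0 * g (enum_val i).
Proof.
move=> n0; rewrite big_enum_val /=; apply: eq_bigr => i _; congr (_ * _).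
by rewrite /pr (mu_cylinder 0 (enum_valP i))// enum_valK_in.
Qed.

(** The eigenvector is normalised, so the legal cylinders already have total mass 1 and the illegal
    ones are null. *)
Lemma pr_sum n (g : word -> R) : (0 < n)%N ->
  \sum_(w : n.-tuple bool) pr (cyl 0 w) * g w = \sum_i PF n i 0 * g (enum_val i).
Proof.
move=> n0; rewrite -pr_legal_sum//.
rewrite (bigID (fun w : n.-tuple bool => w \in legal_words m n)) /= -[RHS]addr0.
congr (_ + _); rewrite big1// => w hw; suff -> : pr (cyl 0 w) = 0 by rewrite mul0r.
have h0 : \sum_(w : n.-tuple bool | w \notin legal_words m n) pr (cyl 0 w) = 0.
  have [lam [_ _ _ s1]] := PF_eigen n0.
  have := pr_partition 0 n (@measurableT _ X).
  rewrite prT (bigID (fun w : n.-tuple bool => w \in legal_words m n)) /=.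
  under eq_bigr do rewrite setTI.
  under [in X in _ + X]eq_bigr do rewrite setTI.
  have := pr_legal_sum (fun=> 1) n0; rewrite -!mulr_suml !mulr1 s1 => ->.
  by move=> h; apply: (@addrI _ 1); rewrite addr0 -h.
by apply: psumr_eq0P h0 _ hw => u _; exact: pr_ge0.
Qed.

(** The constant [c] precedes [A]: the same value serves for every invariant set, in particular for
    the whole space. *)
Lemma cyl_frequency (v : word) (eps : R) : 0 < eps -> exists c : R,
  forall A : set X, measurable A -> @shift_hull m @^-1` A = A ->
  `|pr (A `&` cyl 0 v) - c * pr A| <= 3 * eps.
Proof.
move=> e0; have e20 : 0 < eps ^+ 2 by rewrite exprn_gt0.
have [k [n0 [c [c01 hc]]]] := window_concentration p_ge0 p_sum1 m_gt0 v e20.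
exists c => A mA sA.
pose n := (n0 + (Num.truncn ((size v)%:R / eps)).+1)%N.
have n_gt0 : (0 < n)%N by rewrite /n addnS.
have n0R : 0 < n%:R :> R by rewrite ltr0n.
have nv : (size v)%:R <= eps * n%:R.
  rewrite mulrC -ler_pdivrMr//; apply: le_trans (ltW (truncnS_gt _)) _.
  by rewrite ler_nat leq_addl.
pose G := centred v c.
have sq : \sum_(w : n.-tuple bool) pr (cyl 0 w) * G w ^+ 2 <= eps ^+ 2 * n%:R ^+ 2.
  rewrite (pr_sum (fun w => G w ^+ 2) n_gt0).
  have [lam [_ Mv v0 s1]] := PF_eigen n_gt0.
  apply: (eigenvector_average_le p_ge0 p_sum1 n_gt0 Mv v0 s1
    (g := fun w => G w ^+ 2) (k := k)) => w j sw jw.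
  by apply: hc => //; rewrite leq_addr.
have mc (w : word) : measurable (cyl 0 w : set X) := measurable_hull_cylinder 0 w.
(* From second to first moment by [t * x <= t ^+ 2 + x ^+ 2] with [t = eps * n] and [x] the absolute
   value of [G w]; the intersection with [A] is dropped by monotonicity. *)
have abs : \sum_(w : n.-tuple bool) pr (A `&` cyl 0 w) * `|G w| <= 2 * eps * n%:R.
  apply: le_trans (_ : \sum_(w : n.-tuple bool)
    (eps * n%:R * pr (cyl 0 w) + (eps * n%:R)^-1 * (pr (cyl 0 w) * G w ^+ 2)) <= _).
    apply: ler_sum => w _.
    apply: le_trans (_ : pr (cyl 0 w) * `|G w| <= _).
      rewrite ler_wpM2r//; apply: pr_le (measurableI _ _ mA (mc w)) (mc w) _.
      exact: subIsetr.
    rewrite [X in X + _]mulrC [X in _ + X]mulrCA -mulrDr ler_wpM2l ?pr_ge0//.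
    have t0 : 0 < eps * n%:R by rewrite mulr_gt0.
    rewrite -(ler_pM2l t0) [leRHS]mulrDr mulVKf ?gt_eqF//.
    have : 0 <= (eps * n%:R - `|G w|) ^+ 2 by exact: sqr_ge0.
    have : 0 <= eps * n%:R * `|G w| by rewrite mulr_ge0// ltW.
    by rewrite -[G w ^+ 2]real_normK ?num_real// !expr2; lra.
  rewrite big_split /= -!mulr_sumr.
  have -> : \sum_(w : n.-tuple bool) pr (cyl 0 w) = 1.
    rewrite -prT (pr_partition 0 n measurableT).
    by under [RHS]eq_bigr do rewrite setTI.
  rewrite mulr1 -mulrA [leRHS]mulrDl mul1r lerD2l.
  rewrite ler_pdivrMl ?mulr_gt0//; apply: le_trans sq _.
  by rewrite -!expr2 exprMn.
have GE : \sum_(w : n.-tuple bool) pr (A `&` cyl 0 w) * G w =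
    \sum_(w : n.-tuple bool) pr (A `&` cyl 0 w) * (occ v w)%:R - c * n%:R * pr A.
  rewrite (pr_partition 0 n mA) mulr_sumr -sumrB; apply: eq_bigr => w _.
  by rewrite /G /centred size_tuple; ring.
have h1 := occ_expectation v n mA sA.
have h2 : `|\sum_(w : n.-tuple bool) pr (A `&` cyl 0 w) * G w| <= 2 * eps * n%:R.
  apply: le_trans (ler_norm_sum _ _ _) _; apply: le_trans abs.
  by apply: ler_sum => w _; rewrite normrM ger0_norm ?pr_ge0.
rewrite GE in h2.
rewrite -(ler_pM2l n0R) -{1}(ger0_norm (ltW n0R)) -normrM.
move: h1 h2; rewrite !ler_norml => /andP[? ?] /andP[? ?].
by apply/andP; split; lra.
Qed.

Lemma invariant_independent_cyl (A : set X) k (v : word) :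
  measurable A -> @shift_hull m @^-1` A = A ->
  pr (A `&` cyl k v) = pr A * pr (cyl k v).
Proof.
move=> mA sA; rewrite (pr_shift k v mA sA) -[cyl k v]setTI.
rewrite (pr_shift k v (@measurableT _ X) (preimage_setT _)) setTI.
apply/eqP; rewrite -subr_eq0 -normr_le0; apply/ler_addgt0Pr => e e0; rewrite add0r.
(* The frequency bound is used for [A] and for the whole space with the same [c]; each use costs
   [3 * (e / 6)], half of [e]. *)
have [|c hc] := @cyl_frequency v (e / 6); first by rewrite divr_gt0.
have := hc _ mA sA.
have := hc _ (@measurableT _ X) (preimage_setT _).
rewrite setTI prT mulr1.
have pA0 := pr_ge0 A; have pA1 : pr A <= 1 by rewrite -prT pr_le.
rewrite !ler_norml => /andP[a1 a2] /andP[a3 a4]; apply/andP; split; nra.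
Qed.

End against_eigenvectors.
End ergodicity.

Theorem theorem4p4 (R : realType) (m : nat) (m_gt0 : (0 < m)%N)
    (p : 'I_m.+1 -> R) (p_gt0 : forall j, 0 < p j) (p_sum1 : \sum_j p j = 1)
    (PF : forall l : nat, 'cV[R]_#|legal_words m l|)
    (PF_eigen : forall l : nat, (0 < l)%N ->
       right_PF_eigenvector (induced_matrix p l) (PF l))
    (mu : probability (hull_borel m) R)
    (mu_inv : invariant_measure mu (@shift_hull m))
    (mu_cylinder : forall (k : int) (l : nat) (w : l.-tuple bool)
       (hw : w \in legal_words m l), (0 < l)%N ->
       mu (@hull_cylinder m k w) = (PF l (enum_rank_in hw w) 0)%:E) :
  ergodic mu (@shift_hull m).
Proof.
split; first exact: measurable_shift_hull.
split => // A mA sA.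
have p_ge0 j : 0 <= p j := ltW (p_gt0 j).
(* Independence of [A] from cylinders says that [mu] restricted to [A] and [mu] scaled by [pr mu A]
   agree on a generating pi-system, hence on [A] itself. *)
pose m1 : measure (hull_borel m) R := mrestr mu mA.
pose m2 : measure (hull_borel m) R := mscale (NngNum (pr_ge0 mu A)) mu.
have indep : m1 A = m2 A.
  apply: (@measure_unique _ R (hull_borel m) (@central_cylinders m) (fun=> setT)) => //.
  - exact: measurable_central_cylinders.
  - exact: setI_closed_central_cylinders.
  - move=> _; exists (0%N, [::]) => //=.
    by rewrite central_cylinderE /= hull_cylinder_nil.
  - exact: bigcup_const.
  - move=> _ [[n w] _ <-] /=; rewrite central_cylinderE; case: ifP => _; last first.
      by rewrite !measure0.
    rewrite /m1 /m2 /mrestr /mscale /= setIC prE; last first.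
      by apply: measurableI => //; exact: measurable_hull_cylinder.
    rewrite (prE mu (measurable_hull_cylinder _ _)) -EFinM.
    by rewrite (invariant_independent_cyl m_gt0 p_ge0 p_sum1 mu_inv PF_eigen mu_cylinder).
  - move=> _; rewrite -[m1 setT]/(mu (setT `&` A)) ltey_eq fin_num_measure//.
    by rewrite setTI.
(* Evaluated at [A], the equality says that [pr mu A] is its own square. *)
move: indep; rewrite -[m1 A]/(mu (A `&` A)) -[m2 A]/((pr mu A)%:E * mu A)%E.
rewrite setIid (prE mu mA) -EFinM => -[h].
have /eqP : pr mu A * (pr mu A - 1) = 0 by rewrite mulrBr mulr1 -h subrr.
by rewrite mulf_eq0 subr_eq0 => /orP[] /eqP ->; [left|right].
Qed.
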